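(* Assume $n>1$. In the propositional language with atoms $p_1,\ldots,p_n$ extended by a modal operator $K$, the following system is consistent ($\phi,\psi$ range over all formulas): (1) (Local) $K(\phi)\rightarrow\phi$; (2) (Global) $K(\phi\rightarrow\psi)\rightarrow (K(\phi)\rightarrow K(\psi))$; (3) (Global) $T_n$, by which is meant $p_1\vee\cdots\vee p_n$; (4) (Global) $\left(\bigwedge_{i=1}^n \neg K(p_i)\right)\vee K(\bot)$; (5) (Global) $\bigwedge_{i=1}^n ((\neg T_i)\rightarrow K(\neg T_i))$, where $T_i$ abbreviates $p_1\vee\cdots\vee p_i$; (6) the rule of global necessitation for $K$.
   Context: $\bot$ is some fixed contradiction, such as $p_1\wedge\neg p_1$. Semantics: a model assigns arbitrary truth values to the atoms and to the formulas of the form $K(\phi)$; connectives are interpreted classically. A formula is logically valid if it is true in every model (i.e., it is a classical tautology with formulas $K(\phi)$ treated as additional atoms). Systems and derivability: for a system $S$ consisting of a set of global axioms, a set of local axioms, and the rule of global necessitation for $K$ (with modus ponens implicitly included), $S\models\phi$ means that there is a finite sequence $\phi_1,\ldots,\phi_m$ with $\phi_m=\phi$ such that for each $i$ one of the following holds: (i) $\phi_i$ is a local axiom; (ii) $\phi_i$ is a global axiom; (iii) $\phi_i$ is logically valid; (iv) $\phi_i$ follows from two earlier members of the sequence by modus ponens; (v) $\phi_i$ is $K(\phi_j)$ for some $j<i$ such that for every $1\le k\le j$, $\phi_k$ is an instance of one of items (ii)-(v) of this list (so local axioms are not used up to step $j$). The system is consistent if it does not derive a contradiction. *)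

(* Defs.v *)
From mathcomp Require Import all_boot.

Set Implicit Arguments.
Unset Strict Implicit.
Unset Printing Implicit Defensive.

(* The atom p_i of the paper is [Atom i] with [i : 'I_n] counted from 0. *)
Inductive form (n : nat) : Type :=
| Atom of 'I_n
| Neg of form n
| And of form n & form n
| Or of form n & form n
| Imp of form n & form n
| K of form n.

Record model (n : nat) := Model {
  atom_val : 'I_n -> bool;
  K_val : form n -> bool
}.

Fixpoint eval (n : nat) (M : model n) (phi : form n) : bool :=
  match phi with
  | Atom i => atom_val M i
  | Neg a => ~~ eval M a
  | And a b => eval M a && eval M b
  | Or a b => eval M a || eval M b
  | Imp a b => eval M a ==> eval M b
  | K a => K_val M a
  end.

Definition logically_valid (n : nat) (phi : form n) : Prop :=
  forall M : model n, eval M phi.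

Definition contradiction (n : nat) (phi : form n) : Prop :=
  forall M : model n, ~~ eval M phi.

(* Global necessitation is part of derivability, below, and so is not a
   field. *)
Record system (n : nat) := System {
  local_axiom : form n -> Prop;
  global_axiom : form n -> Prop
}.

Section Derivations.
Variables (n m : nat) (S : system n) (s : 'I_m.+1 -> form n).

(* Step [i] of the sequence [s] is justified without being a local axiom.  In
   [by_nec] the steps up to [j] must all be justified in this same sense; since
   [j < i] this self-reference is well founded. *)
Inductive globally_justified (i : 'I_m.+1) : Prop :=
| by_global_axiom : global_axiom S (s i) -> globally_justified i
| by_validity : logically_valid (s i) -> globally_justified i
| by_mp (j k : 'I_m.+1) :
    j < i -> k < i -> s k = Imp (s j) (s i) -> globally_justified i
| by_nec (j : 'I_m.+1) :
    j < i -> s i = K (s j) ->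
    (forall k : 'I_m.+1, k <= j -> globally_justified k) ->
    globally_justified i.

Definition justified (i : 'I_m.+1) : Prop :=
  local_axiom S (s i) \/ globally_justified i.

End Derivations.

Definition derives (n : nat) (S : system n) (phi : form n) : Prop :=
  exists (m : nat) (s : 'I_m.+1 -> form n),
    s ord_max = phi /\ forall i, justified S s i.

Definition consistent (n : nat) (S : system n) : Prop :=
  ~ exists phi : form n, contradiction phi /\ derives S phi.

Section Surprise.
Variables (n : nat) (bot : form n).

(* The values on the empty list play no role when [0 < n]. *)
Definition disj (s : seq (form n)) : form n :=
  if s is x :: s' then foldl (@Or n) x s' else bot.

Definition conj (s : seq (form n)) : form n :=
  if s is x :: s' then foldl (@And n) x s' else Neg bot.

(* [T i] is the disjunction of the first [i] atoms, so [T 1] is p_1. *)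
Definition T (i : nat) : form n :=
  disj [seq Atom j | j : 'I_n <- enum 'I_n & j < i].

Inductive is_reflection : form n -> Prop :=
| Reflection phi : is_reflection (Imp (K phi) phi).

Inductive is_global : form n -> Prop :=
| Distribution phi psi :
    is_global (Imp (K (Imp phi psi)) (Imp (K phi) (K psi)))
| SomeAtom : is_global (T n)
| NoKnownAtom :
    is_global (Or (conj [seq Neg (K (Atom i)) | i <- enum 'I_n]) (K bot))
| NegTKnown :
    is_global
      (conj [seq Imp (Neg (T i.+1)) (K (Neg (T i.+1))) | i : 'I_n <- enum 'I_n]).

Definition surprise_system : system n := System is_reflection is_global.

End Surprise.

(* Main.v *)
Require Import Defs.
From mathcomp Require Import all_boot.

(** The system is consistent because it is sound for a Kripke structure with
    two worlds: the eve of the first day, [eve], where only the first atom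
    holds and which sees itself and the other world, and [doomsday], where only
    the last atom holds and which sees no world at all.

    The global axioms are true at both worlds.  At [doomsday] every [K phi]
    holds, vacuously, including [K bot], which is what the fourth axiom asks of
    a world where the last day has come.  At [eve] no atom is known: as [n > 1],
    the two worlds have no true atom in common; and each [T i] with [1 <= i]
    holds there, so that the fifth axiom is vacuous.  The local axioms
    [K phi -> phi] hold at [eve], which sees itself; [K bot -> bot] fails at
    [doomsday], which is harmless as local axioms are never necessitated.  By
    [derives_sound] everything derivable is true at [eve], and a contradiction
    is not. *)

Set Implicit Arguments.
Unset Strict Implicit.
Unset Printing Implicit Defensive.

Section Soundness.
Variables (n : nat) (S : system n) (W : model n -> Prop).
Hypothesis global_true :
  forall M phi, W M -> global_axiom S phi -> eval M phi.
Hypothesis necessitation_true :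
  forall M phi, W M -> (forall M', W M' -> eval M' phi) -> K_val M phi.

(** A step that is globally justified by itself may still follow by modus
    ponens from local axioms and fail at some worlds; this is why the hypothesis
    covers the whole initial segment. *)
Lemma global_segment_sound m (s : 'I_m.+1 -> form n) (j : 'I_m.+1) :
  (forall k : 'I_m.+1, k <= j -> globally_justified S s k) ->
  forall k : 'I_m.+1, k <= j -> forall M, W M -> eval M (s k).
Proof.
move=> justs k; have [b] := ubnP (val k).
elim: b k => // b IHb k ltkb lekj M WM.
have IH (l : 'I_m.+1) : l < k -> forall M', W M' -> eval M' (s l).
  by move=> ltlk; apply: IHb; [exact: leq_trans ltlk ltkb | exact: leq_trans (ltnW ltlk) lekj].
case: (justs k lekj) => [ax|valid|i l ltik ltlk sl|i ltik -> _].
- exact: global_true.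
- exact: valid.
- by have := IH l ltlk M WM; rewrite sl /= IH.
- by apply: necessitation_true => //; apply: IH.
Qed.

(** The set [W] plays the part of a Kripke structure in which the local axioms
    are required at a single world.  Of its accessibility relation the only
    trace is that each member of [W] knows what is true throughout [W], which is
    all that necessitation asks. *)
Lemma derives_sound M phi :
  W M -> (forall psi, local_axiom S psi -> eval M psi) ->
  derives S phi -> eval M phi.
Proof.
move=> WM local_true [m [s [<- justs]]]; move: ord_max => i.
have [b] := ubnP (val i); elim: b i => // b IHb i ltib.
have IH (l : 'I_m.+1) : l < i -> eval M (s l).
  by move=> ltli; apply: IHb; exact: leq_trans ltli ltib.
case: (justs i) => [|[ax|valid|j l ltji ltli sl|j ltji -> gjusts]].
- exact: local_true.
- exact: global_true.
- exact: valid.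
- by have := IH l ltli; rewrite sl /= IH.
- by apply: necessitation_true => // M'; apply: global_segment_sound gjusts _ _ _.
Qed.

End Soundness.

Section BigConnectives.
Variables (n : nat) (bot : form n) (bot_contra : contradiction bot).

Lemma eval_disj M (s : seq (form n)) : eval M (disj bot s) = has (eval M) s.
Proof.
case: s => [|x s] /=; first exact/negbTE/bot_contra.
by elim: s x => [|y s IHs] x /=; rewrite ?orbF // IHs orbA.
Qed.

Lemma eval_conj M (s : seq (form n)) : eval M (conj bot s) = all (eval M) s.
Proof.
case: s => [|x s] /=; first exact/bot_contra.
by elim: s x => [|y s IHs] x /=; rewrite ?andbT // IHs andbA.
Qed.

Lemma eval_T M i (j : 'I_n) : j < i -> atom_val M j -> eval M (T bot i).
Proof.
move=> ltji Mj; rewrite eval_disj has_map; apply/hasP; exists j => //.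
by rewrite mem_filter ltji mem_enum.
Qed.

End BigConnectives.

Section TwoWorlds.
Variable n : nat.

Definition doomsday : model n.+1 :=
  Model (fun i => i == ord_max) (fun=> true).

(** Truth at [eve] has to be defined before [eve] itself, whose valuation of
    the formulas [K phi] refers to it; [eval_eve] closes the loop. *)
Fixpoint true_on_eve (phi : form n.+1) : bool :=
  match phi with
  | Atom i => i == ord0
  | Neg a => ~~ true_on_eve a
  | And a b => true_on_eve a && true_on_eve b
  | Or a b => true_on_eve a || true_on_eve b
  | Imp a b => true_on_eve a ==> true_on_eve b
  | K a => true_on_eve a && eval doomsday a
  end.

Definition eve : model n.+1 :=
  Model (fun i => i == ord0) (fun phi => true_on_eve phi && eval doomsday phi).

Lemma eval_eve phi : eval eve phi = true_on_eve phi.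
Proof. by elim: phi => //= [a ->|a -> b ->|a -> b ->|a -> b ->]. Qed.

Lemma K_val_eve phi : K_val eve phi = eval eve phi && eval doomsday phi.
Proof. by rewrite eval_eve. Qed.

Variables (bot : form n.+1) (bot_contra : contradiction bot).

Lemma doomsday_global phi : is_global bot phi -> eval doomsday phi.
Proof.
case=> [a b||/=|] //.
- by apply: (eval_T bot_contra (j := ord_max)) => //=.
- by rewrite orbT.
- by rewrite eval_conj // all_map; apply/allP => i _ /=; rewrite implybT.
Qed.

Lemma eve_global phi : 0 < n -> is_global bot phi -> eval eve phi.
Proof.
move=> n_gt0 [a b|||].
- rewrite /= -!eval_eve /=.
  by do !case: (eval _ _).
- exact: (eval_T bot_contra (j := ord0)).
- rewrite /= eval_conj // all_map; apply/orP; left.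
  (* An atom known at [eve] would have to be both the first and the last. *)
  apply/allP => i _ /=; apply/negP => /andP[/eqP-> /eqP/(congr1 val) /= n0].
  by rewrite -n0 in n_gt0.
- rewrite eval_conj // all_map; apply/allP => i _ /=.
  by rewrite (eval_T bot_contra (j := ord0)).
Qed.

End TwoWorlds.

Theorem theorem3p1 (n : nat) (n_gt1 : 1 < n) (bot : form n)
  (bot_contra : contradiction bot) : consistent (surprise_system bot).
Proof.
case: n n_gt1 bot bot_contra => // n n_gt0 bot bot_contra [phi [phi_contra der]].
pose W M := M = eve n \/ M = doomsday n.
suff: eval (eve n) phi by apply/negP/phi_contra.
apply: (derives_sound (W := W)) der => [M psi|M psi||psi].
- by case=> ->; [apply: eve_global | apply: doomsday_global].
- case=> -> // true_psi.
  by rewrite K_val_eve !true_psi //; [right | left].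
- by left.
- by case=> a; apply/implyP => /=; rewrite -eval_eve => /andP[].
Qed.
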